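(* The map $\mathcal{P}\times\mathbb{R}_{>0}\rightarrow\mathcal{R}$, $(p,k)\mapsto elo_k(p)$, is continuous. For all $p,q\in\mathcal{P}$ and $k>0$, $$\lVert elo_k(p)-elo_k(q)\rVert_1\leq 2\cdot k\cdot\lVert p-q\rVert_1.$$
   Context: Fix $n\in\mathbb{N}$ with $n\geq 2$ and identify $n=\{0,1,\dots,n-1\}$ (so $i\in n$ means $0\le i\le n-1$). The rating space is $\mathcal{R}:=\{x\in\mathbb{R}^n\mid\sum_{i\in n}x_i=0\}$, with norm $\lVert\cdot\rVert_1$. The space of competition results is $\mathcal{P}:=\{p\in\mathbb{R}^{n\times n}\mid p_{ij}\geq 0\text{ for all }i,j\in n,\ p_{ii}=0\text{ for all }i\in n\}$, with the metric induced by the entrywise norm $\lVert\cdot\rVert_1$ on $\mathbb{R}^{n\times n}$ (sum of absolute values of all entries). For $k>0$, the classical Elo map is $$elo_k^{cl}:\mathcal{R}\times\mathcal{P}\rightarrow\mathcal{R},\quad (x,p)\mapsto k\cdot\left(\sum_{j\in n}\left(p_{ij}-\frac{p_{ij}+p_{ji}}{1+\exp(x_j-x_i)}\right)\right)_{i\in n}.$$ For every $k>0$ and $p\in\mathcal{P}$ there is exactly one $x\in\mathcal{R}$ with $x=elo_k^{cl}(x,p)$; it is denoted $elo_k(p)$ (the self-justifying rating with respect to $p$ and $k$), defining a map $elo_k:\mathcal{P}\to\mathcal{R}$. *)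

(* Defs.v *)
From mathcomp Require Import all_boot all_order all_algebra.
From mathcomp Require Import all_classical all_reals all_analysis.

Set Implicit Arguments.
Unset Strict Implicit.
Unset Printing Implicit Defensive.

Import Order.TTheory GRing.Theory Num.Theory.
Import numFieldNormedType.Exports.
Local Open Scope classical_set_scope.
Local Open Scope ring_scope.

Definition l1norm (R : realType) (m n : nat) (A : 'M[R]_(m, n)) : R :=
  \sum_(i < m) \sum_(j < n) `|A i j|.

(* MathComp-Analysis gives 'M[R]_(m, n) the entrywise topology; this lemma
   shows that it is the topology of the metric l1norm (A - B). *)
Lemma nbhs_l1normE (R : realType) (m n : nat) (A : 'M[R]_(m, n))
    (U : set 'M[R]_(m, n)) :
  nbhs A U <->
  exists2 e : R, 0 < e & forall B, l1norm (A - B) < e -> U B.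
Proof.
rewrite -nbhs_ballE; split=> [[e /= e0 eU]|[e e0 eU]].
  exists e => // B ABe; apply: eU; split => // i j.
  rewrite /ball /=; apply: le_lt_trans ABe.
  rewrite /l1norm (bigD1 i) //= (bigD1 j) //= !mxE -addrA lerDl addr_ge0 //.
    by apply: sumr_ge0.
  by apply: sumr_ge0 => i' _; apply: sumr_ge0.
have d0 : 0 < e / (m * n).+1%:R by rewrite divr_gt0.
exists (e / (m * n).+1%:R) => //= B [_ AB]; apply: eU.
apply: (@le_lt_trans _ _ (\sum_(i < m) \sum_(j < n) (e / (m * n).+1%:R))).
  apply: ler_sum => i _; apply: ler_sum => j _; rewrite !mxE ltW //.
  exact: AB.
rewrite !sumr_const !card_ord -mulrnA -[X in X < _]mulr_natr mulrAC ltr_pdivrMr //.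
by rewrite ltr_pM2l // ltr_nat ltnS mulnC.
Qed.

Definition rating_space (R : realType) (n : nat) : set 'rV[R]_n :=
  [set x | \sum_(i < n) x ord0 i = 0].

Definition competition_results (R : realType) (n : nat) : set 'M[R]_n :=
  [set p | (forall i j, 0 <= p i j) /\ (forall i, p i i = 0)].

Definition elo_cl (R : realType) (n : nat) (k : R) (x : 'rV[R]_n)
    (p : 'M[R]_n) : 'rV[R]_n :=
  k *: \row_(i < n) \sum_(j < n)
    (p i j - (p i j + p j i) / (1 + expR (x ord0 j - x ord0 i))).

(* The self-justifying rating: the unique fixed point of x |-> elo_cl k x p in
   the rating space, which exists for 0 < k and p in competition_results. *)
Definition elo (R : realType) (n : nat) (k : R) (p : 'M[R]_n) : 'rV[R]_n :=
  xget 0 [set x | rating_space x /\ x = elo_cl k x p].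

(* Main.v *)
(* The Elo map depends on (p, k) only through k p, so one may take k = 1.  A
   self-justifying rating exists by Banach's theorem: although the Elo map need
   not be contracting, the relaxed map x |-> (1 - t) x + t elo_cl 1 x p has the
   same fixed points and contracts the sup norm by the factor 1 - t when t > 0 is
   small, because the logistic function is increasing and 1-Lipschitz.
   Monotonicity also gives ||x - y||_1 <= 2 ||k p - l q||_1 for fixed points x, y
   belonging to (p, k) and (q, l), from which both claims follow. *)
Require Import Defs.
From HB Require Import structures.
From mathcomp Require Import all_boot all_order all_algebra.
From mathcomp Require Import all_classical all_reals all_analysis.
From mathcomp Require Import ring lra.

Set Implicit Arguments.
Unset Strict Implicit.
Unset Printing Implicit Defensive.

Import Order.TTheory GRing.Theory Num.Theory.
Import numFieldNormedType.Exports.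
Local Open Scope classical_set_scope.
Local Open Scope ring_scope.

(* MathComp-Analysis provides the complete and the normed structure on matrices
   but not their join. *)
HB.instance Definition _ (R : realType) (m n : nat) :=
  Complete.on 'M[R]_(m, n).

Definition logistic (R : realType) (u : R) : R := (1 + expR (- u))^-1.

(* The junk value x / 0 = 0 makes [logistic_slope u u] equal to 0. *)
Definition logistic_slope (R : realType) (u v : R) : R :=
  (logistic u - logistic v) / (u - v).

Definition relaxed_elo_cl (R : realType) (n : nat) (p : 'M[R]_n) (t : R)
    (x : 'rV[R]_n) : 'rV[R]_n :=
  (1 - t) *: x + t *: elo_cl 1 x p.

(** * The logistic function and its difference quotients *)

Lemma logistic_ge0 (R : realType) (u : R) : 0 <= logistic u.
Proof. by rewrite invr_ge0 addr_ge0 ?expR_ge0. Qed.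

Lemma logistic_le1 (R : realType) (u : R) : logistic u <= 1.
Proof.
by rewrite invf_le1 ?lerDl ?expR_ge0 // ltr_pwDl ?expR_ge0.
Qed.

Lemma logisticN (R : realType) (u : R) : logistic (- u) = 1 - logistic u.
Proof.
rewrite /logistic opprK expRN; have e0 := expR_gt0 u.
by field; rewrite !gt_eqF ?addr_gt0.
Qed.

Lemma logistic_slopeE (R : realType) (u v : R) :
  logistic u - logistic v = logistic_slope u v * (u - v).
Proof.
rewrite /logistic_slope; have [->|uv] := eqVneq u v.
  by rewrite !subrr mulr0.
by rewrite divfK // subr_eq0.
Qed.

Lemma logistic_slopeC (R : realType) (u v : R) :
  logistic_slope u v = logistic_slope v u.
Proof.
by rewrite /logistic_slope -(opprB v u) invrN mulrN -mulNr opprB.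
Qed.

Lemma logistic_slope_itv (R : realType) (u v : R) :
  0 <= logistic_slope u v <= 1.
Proof.
wlog vu : u v / v < u => [H|].
  have [uv|/H//|->] := ltgtP u v; first by rewrite logistic_slopeC H.
  by rewrite /logistic_slope !subrr mul0r lexx ler01.
have uv0 : 0 < u - v by rewrite subr_gt0.
have a0 := expR_gt0 (- u); have b0 := expR_gt0 (- v).
have ab : expR (- u) <= expR (- v) by rewrite ler_expR lerN2 ltW.
have diffE : logistic u - logistic v =
    (expR (- v) - expR (- u)) / ((1 + expR (- u)) * (1 + expR (- v))).
  by rewrite /logistic; field; rewrite !gt_eqF ?addr_gt0.
have den0 : 0 < (1 + expR (- u)) * (1 + expR (- v)).
  by rewrite mulr_gt0 ?addr_gt0.
rewrite /logistic_slope diffE; apply/andP; split.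
  by rewrite !divr_ge0 ?subr_ge0 //; exact: ltW.
rewrite ler_pdivrMr // mul1r ler_pdivrMr //.
(* The tangent line of the exponential at 0 bounds the numerator by [expR (- v) * (u - v)], and
   [expR (- v)] is at most the product in [den0]. *)
have h : expR (- v) * (1 + (v - u)) <= expR (- u).
  rewrite -[X in _ <= expR X](_ : - v + (v - u) = - u); last by ring.
  by rewrite expRD ler_pM2l // expR_ge1Dx.
nra.
Qed.

Lemma logistic_slope_ge0 (R : realType) (u v : R) : 0 <= logistic_slope u v.
Proof. by have /andP[] := logistic_slope_itv u v. Qed.

Lemma logistic_slope_le1 (R : realType) (u v : R) : logistic_slope u v <= 1.
Proof. by have /andP[] := logistic_slope_itv u v. Qed.

(** * Algebra of the Elo map *)

Lemma elo_clE (R : realType) (n : nat) (k : R) (x : 'rV[R]_n) (p : 'M[R]_n) i :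
  elo_cl k x p ord0 i = k * \sum_(j < n)
    (p i j * logistic (x ord0 j - x ord0 i) -
     p j i * logistic (x ord0 i - x ord0 j)).
Proof.
rewrite !mxE; congr (_ * _); apply: eq_bigr => j _.
rewrite -(opprB (x ord0 i)) logisticN /logistic.
rewrite mulrBr mulr1 mulrDl; ring.
Qed.

(** The summand in [elo_clE] is antisymmetric in [i] and [j], so its double sum vanishes. Hence
    fixed points may be sought in all of ['rV[R]_n]: they have coordinate sum 0 automatically. *)
Lemma elo_cl_rating_space (R : realType) (n : nat) (k : R) (x : 'rV[R]_n)
    (p : 'M[R]_n) :
  rating_space (elo_cl k x p).
Proof.
rewrite /rating_space /=; under eq_bigr do rewrite elo_clE sumrB.
by rewrite -mulr_sumr sumrB exchange_big /= subrr mulr0.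
Qed.

Lemma elo_cl_scale (R : realType) (n : nat) (k : R) (x : 'rV[R]_n)
    (p : 'M[R]_n) :
  elo_cl k x p = elo_cl 1 x (k *: p).
Proof.
apply/rowP => i; rewrite !elo_clE mul1r mulr_sumr; apply: eq_bigr => j _.
by rewrite !mxE mulrBr !mulrA.
Qed.

Lemma elo_scale (R : realType) (n : nat) (k : R) (p : 'M[R]_n) :
  elo k p = elo 1 (k *: p).
Proof.
rewrite /elo; congr (xget _ _); apply/seteqP; split => x /=.
  by rewrite elo_cl_scale.
by rewrite (elo_cl_scale k).
Qed.

Lemma competition_resultsZ (R : realType) (n : nat) (k : R) (p : 'M[R]_n) :
  0 <= k -> competition_results p -> competition_results (k *: p).
Proof.
move=> k0 [p0 pd]; split => [i j|i]; rewrite !mxE ?pd ?mulr0 //.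
exact: mulr_ge0.
Qed.

(** * Norm estimates, existence and stability of fixed points *)

Lemma l1norm_ge0 (R : realType) (m n : nat) (A : 'M[R]_(m, n)) :
  0 <= l1norm A.
Proof. by apply: sumr_ge0 => i _; apply: sumr_ge0. Qed.

Lemma l1normZ (R : realType) (m n : nat) (k : R) (A : 'M[R]_(m, n)) :
  l1norm (k *: A) = `|k| * l1norm A.
Proof.
rewrite /l1norm mulr_sumr; apply: eq_bigr => i _; rewrite mulr_sumr.
by apply: eq_bigr => j _; rewrite mxE normrM.
Qed.

Lemma mulr_sg_diff_le0 (R : realDomainType) (a b : R) :
  (Num.sg a - Num.sg b) * (b - a) <= 0.
Proof.
by case: sgrP => ha; case: sgrP => hb; lra.
Qed.

Lemma norm_mx_le (R : realType) (m n : nat) (A : 'M[R]_(m, n)) (M : R) :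
  0 <= M -> (forall i j, `|A i j| <= M) -> `|A| <= M.
Proof.
move=> M0 AM; rewrite [leLHS]mx_normrE.
by apply: bigmax_le => // -[i j] _; exact: AM.
Qed.

Lemma le_norm_mx (R : realType) (m n : nat) (A : 'M[R]_(m, n)) i j :
  `|A i j| <= `|A|.
Proof.
by rewrite [leRHS]mx_normrE (le_bigmax _ (fun ij => `|A ij.1 ij.2|) (i, j)).
Qed.

(* The difference of the two images has the entries
   (1 - t) d_i + t \sum_j w_ij (d_j - d_i) with d = x - y and weights w_ij >= 0,
   a combination with nonnegative coefficients of total 1 - t. *)
Lemma relaxed_elo_cl_lipschitz (R : realType) (n : nat) (p : 'M[R]_n) (t : R)
    (x y : 'rV[R]_n) :
  competition_results p -> 0 <= t -> t * (1 + 2 * l1norm p) <= 1 ->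
  `|relaxed_elo_cl p t x - relaxed_elo_cl p t y| <= (1 - t) * `|x - y|.
Proof.
move=> [p0 _] t0 tS; set M := `|x - y|.
have S0 := l1norm_ge0 p.
have t1 : 0 <= 1 - t by nra.
apply: norm_mx_le => [|r i]; first by rewrite mulr_ge0 // normr_ge0.
rewrite (ord1 r); pose d j := x ord0 j - y ord0 j.
have dM j : `|d j| <= M by have := le_norm_mx (x - y) ord0 j; rewrite !mxE.
pose c a b := logistic_slope (x ord0 b - x ord0 a) (y ord0 b - y ord0 a).
pose w j := p i j * c i j + p j i * c j i.
have w0 j : 0 <= w j by rewrite addr_ge0 // mulr_ge0 ?logistic_slope_ge0.
have rowp : \sum_j p i j <= l1norm p.
  apply: (@le_trans _ _ (\sum_j `|p i j|)).
    by apply: ler_sum => j _; exact: ler_norm.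
  rewrite /l1norm [leRHS](bigD1 i) //= lerDl.
  by apply: sumr_ge0 => ? _; exact: sumr_ge0.
have colp : \sum_j p j i <= l1norm p.
  rewrite /l1norm; apply: ler_sum => j _.
  rewrite (bigD1 i) //= ger0_norm // lerDl.
  exact: sumr_ge0.
have W : \sum_j w j <= 2 * l1norm p.
  apply: (@le_trans _ _ (\sum_j (p i j + p j i))); last first.
    by rewrite big_split /=; lra.
  by apply: ler_sum => j _; apply: lerD; rewrite ler_piMr ?logistic_slope_le1.
have -> : (relaxed_elo_cl p t x - relaxed_elo_cl p t y) ord0 i =
    (1 - t - t * \sum_j w j) * d i + t * \sum_j w j * d j.
  have diffE : elo_cl 1 x p ord0 i - elo_cl 1 y p ord0 i =
      \sum_j w j * d j - (\sum_j w j) * d i.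
    rewrite !elo_clE !mul1r mulr_suml -!sumrB; apply: eq_bigr => j _.
    rewrite /w /c mulrDl.
    have := logistic_slopeE (x ord0 j - x ord0 i) (y ord0 j - y ord0 i).
    have := logistic_slopeE (x ord0 i - x ord0 j) (y ord0 i - y ord0 j).
    (* Solving both slope equations for the logistic values at [x] leaves a polynomial identity. *)
    rewrite /d; move: (logistic_slope _ _) (logistic_slope _ _) => s s'.
    move: (logistic _) (logistic _) (logistic _) (logistic _).
    move=> a b a' b' /(canRL (subrK _)) -> /(canRL (subrK _)) ->; ring.
  move: diffE; rewrite /relaxed_elo_cl; move: (elo_cl 1 x p) (elo_cl 1 y p).
  move=> X Y diffE; rewrite !mxE.
  transitivity ((1 - t) * d i + t * (X ord0 i - Y ord0 i)).
    rewrite /d; ring.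
  rewrite diffE; ring.
(* The smallness of [t] enters here: with [W], it keeps the coefficient of [d i] nonnegative. *)
have coef0 : 0 <= 1 - t - t * \sum_j w j.
  have := ler_wpM2l t0 W; lra.
apply: le_trans (ler_normD _ _) _.
rewrite !normrM (ger0_norm coef0) (ger0_norm t0).
have sumwd : `|\sum_j w j * d j| <= (\sum_j w j) * M.
  apply: le_trans (ler_norm_sum _ _ _) _; rewrite mulr_suml.
  by apply: ler_sum => j _; rewrite normrM (ger0_norm (w0 j)) ler_wpM2l.
have := ler_wpM2l t0 sumwd; have := ler_wpM2l coef0 (dM i); lra.
Qed.

Lemma elo_cl_fixpoint (R : realType) (n : nat) (p : 'M[R]_n) :
  competition_results p -> exists x, x = elo_cl 1 x p.
Proof.
(* The relaxation parameter is [S^-1], which turns the smallness condition into an equality. The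
   summand 1 keeps [S] at least 1 even for [p = 0], so the factor [1 - S^-1] lies in [0, 1). *)
move=> pP; set S := 1 + 2 * l1norm p.
have S1 : 1 <= S by rewrite lerDl mulr_ge0 // l1norm_ge0.
have S0 : 0 < S by exact: lt_le_trans S1.
have t0 : 0 < S^-1 by rewrite invr_gt0.
have q0 : 0 <= 1 - S^-1 by rewrite subr_ge0 invf_le1.
pose f := relaxed_elo_cl p S^-1.
have ff : {homo f : x / [set: 'rV[R]_n] x >-> [set: 'rV[R]_n] x} by [].
pose F := mkfun_fun ff.
have ctrF : is_contraction F.
  exists (NngNum q0); split => /=; first by rewrite gtrBl.
  move=> [x y] _ /=; apply: relaxed_elo_cl_lipschitz => //; first exact: ltW.
  by rewrite mulVf // gt_eqF.
have [//|//|x _ fx] := banach_fixed_point ctrF.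
  by exists 0.
(* Cancelling [(1 - S^-1) *: x] and then the factor [S^-1] turns a fixed point of the relaxed map
   into one of the Elo map. *)
exists x; apply: (scalerI (lt0r_neq0 t0)).
apply: (addrI ((1 - S^-1) *: x)); rewrite -[RHS]fx.
by rewrite -scalerDl subrK scale1r.
Qed.

(* Multiply the difference of the fixed point equations by the sign of
   x_i - y_i and sum over i: by monotonicity of the logistic function the terms
   where x and y differ contribute at most 0. *)
Lemma elo_cl_fixpoint_stable (R : realType) (n : nat) (p q : 'M[R]_n)
    (x y : 'rV[R]_n) :
  competition_results p -> x = elo_cl 1 x p -> y = elo_cl 1 y q ->
  l1norm (x - y) <= 2 * l1norm (p - q).
Proof.
move=> [p0 _] fx fy; pose d i := x ord0 i - y ord0 i.
(* [B] changes the ratings while the results stay [p]; [E] changes the results while the ratings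
   stay [y]. *)
pose B i j := p i j * (logistic (x ord0 j - x ord0 i) -
                       logistic (y ord0 j - y ord0 i)).
pose E i j := (p i j - q i j) * logistic (y ord0 j - y ord0 i).
have dE i : d i = \sum_j (B i j - B j i) + \sum_j (E i j - E j i).
  rewrite /d [in LHS]fx [in X in _ - X]fy !elo_clE !mul1r -sumrB -big_split /=.
  by apply: eq_bigr => j _; rewrite /B /E; ring.
have B0 : \sum_i Num.sg (d i) * \sum_j (B i j - B j i) <= 0.
  (* Exchanging [i] and [j] in the part with [B j i] pairs each [B i j] with a difference of signs,
     opposite in sign to [d j - d i]. *)
  have -> : \sum_i Num.sg (d i) * \sum_j (B i j - B j i) =
      \sum_i \sum_j (Num.sg (d i) - Num.sg (d j)) * B i j.
    under eq_bigr do rewrite mulr_sumr.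
    under [RHS]eq_bigr do under eq_bigr do rewrite mulrBl.
    under [RHS]eq_bigr do rewrite sumrB.
    rewrite [RHS]sumrB [X in _ = _ - X]exchange_big -sumrB; apply: eq_bigr => i _.
    by rewrite -sumrB; apply: eq_bigr => j _; rewrite mulrBr.
  apply: sumr_le0 => i _; apply: sumr_le0 => j _.
  rewrite /B logistic_slopeE.
  have -> : x ord0 j - x ord0 i - (y ord0 j - y ord0 i) = d j - d i.
    by rewrite /d; ring.
  rewrite mulrCA mulr_ge0_le0 // mulrCA.
  by rewrite mulr_ge0_le0 ?mulr_sg_diff_le0 ?logistic_slope_ge0.
have E0 : \sum_i Num.sg (d i) * \sum_j (E i j - E j i) <= 2 * l1norm (p - q).
  have Ele i j : `|E i j| <= `|(p - q) i j|.
    rewrite !mxE /E normrM [`|logistic _|]ger0_norm ?logistic_ge0 //.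
    by rewrite ler_piMr ?logistic_le1.
  (* The factor 2 arises because each entry of [E] occurs once in its row and once in its column. *)
  apply: (@le_trans _ _ (\sum_i \sum_j (`|E i j| + `|E j i|))).
    apply: ler_sum => i _; apply: le_trans (ler_norm _) _.
    rewrite normrM; apply: (@le_trans _ _ `|\sum_j (E i j - E j i)|).
      by rewrite ler_piMl // normr_sg; case: (_ == _).
    apply: le_trans (ler_norm_sum _ _ _) _.
    by apply: ler_sum => j _; exact: ler_normB.
  under eq_bigr do rewrite big_split.
  rewrite big_split /= [X in _ + X]exchange_big /= -mulr2n mulr_natl lerMn2r /=.
  by apply: ler_sum => i _; apply: ler_sum.
have -> : l1norm (x - y) = \sum_i Num.sg (d i) * d i.
  rewrite /l1norm big_ord1; apply: eq_bigr => i _.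
  by rewrite !mxE normrEsg.
under eq_bigr do rewrite {2}dE mulrDr.
rewrite big_split /=; lra.
Qed.

(** * The self-justifying rating as a function of results and scale *)

Lemma elo1E (R : realType) (n : nat) (p : 'M[R]_n) :
  competition_results p -> elo 1 p = elo_cl 1 (elo 1 p) p.
Proof.
move=> /elo_cl_fixpoint[x fx].
have fixx : [set x | rating_space x /\ x = elo_cl 1 x p] x.
  by split => //; rewrite fx; exact: elo_cl_rating_space.
by have [] := xgetI 0 fixx.
Qed.

(** Two separate scales serve both claims: [k = l] gives the Lipschitz bound, and varying [l] gives
    joint continuity. *)
Lemma elo_scaled_lipschitz (R : realType) (n : nat) (k l : R) (p q : 'M[R]_n) :
  0 <= k -> 0 <= l -> competition_results p -> competition_results q ->
  l1norm (elo k p - elo l q) <= 2 * l1norm (k *: p - l *: q).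
Proof.
move=> k0 l0 pP qP; rewrite (elo_scale k) (elo_scale l).
by apply: elo_cl_fixpoint_stable; rewrite -?elo1E //; exact: competition_resultsZ.
Qed.

Theorem proposition4p1 (R : realType) (n : nat) (hn : (2 <= n)%N) :
  {within [set pk : 'M[R]_n * R | competition_results pk.1 /\ 0 < pk.2],
    continuous (fun pk : 'M[R]_n * R => elo pk.2 pk.1)} /\
  (forall (p q : 'M[R]_n) (k : R),
    competition_results p -> competition_results q -> 0 < k ->
    l1norm (elo k p - elo k q) <= 2 * k * l1norm (p - q)).
Proof.
split=> [|p q k pP qP k0]; last first.
  have := elo_scaled_lipschitz (ltW k0) (ltW k0) pP qP.
  by rewrite -scalerBr l1normZ gtr0_norm // mulrA.
apply/subspace_continuousP => -[p k] /= [pP k0] U /nbhs_l1normE[e e0 eU].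
have scale_cvg : pk.2 *: pk.1 @[pk --> (p, k)] --> k *: p.
  by apply: cvgZ; [exact: cvg_snd|exact: cvg_fst].
(* The radius [e / 2] offsets the factor 2 in [elo_scaled_lipschitz]. *)
have near_scale : \forall pk \near (p, k),
    l1norm (k *: p - pk.2 *: pk.1) < e / 2.
  apply: (scale_cvg [set B | l1norm (k *: p - B) < e / 2]); apply/nbhs_l1normE.
  by exists (e / 2) => //; exact: divr_gt0.
suff : \forall pk \near (p, k),
    competition_results pk.1 /\ 0 < pk.2 -> U (elo pk.2 pk.1) by [].
apply: filterS near_scale => -[q l] /= scale_lt [qP l0].
apply: eU; apply: le_lt_trans (elo_scaled_lipschitz (ltW k0) (ltW l0) pP qP) _.
by rewrite mulrC -ltr_pdivlMr.
Qed.
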